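(* Fix an error level $\delta\in(0,1/2)$. The minimax memory complexity of uniformity testing satisfies $$S^*(n,\varepsilon)=O\!\left(\frac{n\log n}{\varepsilon}\right).$$ That is, there is a constant $C=C(\delta)$ such that for all integers $n\ge 2$ and all $\varepsilon\in(0,1)$ one has $S^*(n,\varepsilon)\le C\,\frac{n\log n}{\varepsilon}$.
   Context: Let $[n]=\{1,\dots,n\}$, let $u$ be the uniform distribution on $[n]$, and let $d_{\mathsf{TV}}(p,q)=\frac12\sum_{i=1}^n|p_i-q_i|$ for distributions $p,q$ on $[n]$. For $\varepsilon>0$ let $\Theta=\{q \text{ a distribution on }[n]: d_{\mathsf{TV}}(q,u)>\varepsilon\}$. Let $X_1,X_2,\dots$ be i.i.d. samples from a distribution $p$ on $[n]$. The hypotheses are $\mathcal H_0: p=u$ and $\mathcal H_1: p\in\Theta$. An $S$-state uniformity tester consists of an initial state $s_{\rm init}\in[S]$, a (time-invariant, deterministic) transition function $f:[S]\times[n]\to[S]$ and a decision function $d:[S]\to\{\mathcal H_0,\mathcal H_1\}$. The memory evolves by $M_0=s_{\rm init}$, $M_t=f(M_{t-1},X_t)$ for $t\ge1$. Its asymptotic error probabilities are $$\mathsf{P_e}(f,d|\mathcal H_0)=\lim_{t\to\infty}\frac1t\sum_{i=1}^t\Pr\big(d(M_i)=\mathcal H_1\,\big|\,X_1,X_2,\dots\overset{iid}{\sim}u\big),$$ $$\mathsf{P_e}(f,d|\mathcal H_1)=\sup_{p\in\Theta}\ \lim_{t\to\infty}\frac1t\sum_{i=1}^t\Pr\big(d(M_i)=\mathcal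 H_0\,\big|\,X_1,X_2,\dots\overset{iid}{\sim}p\big),$$ with the supremum over the empty set taken to be $0$. The minimax memory complexity $S^*(n,\varepsilon)$ (for the given $\delta$) is the smallest integer $S$ for which there is an $S$-state uniformity tester with $\mathsf{P_e}(f,d|\mathcal H_0)\le\delta$ and $\mathsf{P_e}(f,d|\mathcal H_1)\le\delta$. *)

(* Defs.v *)
From HB Require Import structures.
From mathcomp Require Import all_boot all_order all_algebra.
From mathcomp Require Import all_classical all_reals all_analysis.

Set Implicit Arguments.
Unset Strict Implicit.
Unset Printing Implicit Defensive.

Import Order.TTheory GRing.Theory Num.Theory.
Import numFieldNormedType.Exports.

Local Open Scope classical_set_scope.
Local Open Scope ring_scope.

(* The symbols 1, ..., n and the states 1, ..., S are renumbered from 0, as the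
   elements of 'I_n and 'I_S. *)

Definition is_distribution (R : realType) (n : nat) (p : 'I_n -> R) : Prop :=
  (forall i, 0 <= p i) /\ \sum_(i < n) p i = 1.

Definition uniform_distribution (R : realType) (n : nat) : 'I_n -> R :=
  fun=> n%:R^-1.
Arguments uniform_distribution : clear implicits.

Definition dTV (R : realType) (n : nat) (p q : 'I_n -> R) : R :=
  2^-1 * \sum_(i < n) `|p i - q i|.

Definition Theta (R : realType) (n : nat) (eps : R) : set ('I_n -> R) :=
  [set q | is_distribution q /\ eps < dTV q (uniform_distribution R n)].
Arguments Theta {R} n eps.

(* Probability that (X_1, ..., X_t) satisfies E, for X_1, X_2, ... i.i.d. with
   law p. *)
Definition iid_prob (R : realType) (n : nat) (p : 'I_n -> R) (t : nat)
    (E : pred (t.-tuple 'I_n)) : R :=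
  \sum_(x : t.-tuple 'I_n | E x) \prod_(i < t) p (tnth x i).

Definition hypothesis := bool.
Definition H0 : hypothesis := false.
Definition H1 : hypothesis := true.

Record tester (n S : nat) := Tester {
  init_state : 'I_S;
  transition : 'I_S -> 'I_n -> 'I_S;
  decision : 'I_S -> hypothesis }.

(* M_t as a function of the samples X_1, ..., X_t. *)
Definition memory (n S : nat) (T : tester n S) (t : nat)
    (x : t.-tuple 'I_n) : 'I_S :=
  foldl (transition T) (init_state T) x.

(* Asymptotic frequency of the decision h under i.i.d. samples from p. The
   limit exists for every distribution p, since (M_t) is then a Markov chain on
   a finite state space. *)
Definition decision_freq (R : realType) (n S : nat) (T : tester n S)
    (h : hypothesis) (p : 'I_n -> R) : R :=
  limn (fun t : nat => t%:R^-1 *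
    \sum_(1 <= i < t.+1)
      iid_prob p (fun x : i.-tuple 'I_n => decision T (memory T x) == h)).

Definition error_H0 (R : realType) (n S : nat) (T : tester n S) : R :=
  decision_freq T H1 (uniform_distribution R n).

(* The values are frequencies in [0, 1], so the real supremum is the genuine one
   when Theta is nonempty; by convention sup set0 = 0. *)
Definition error_H1 (R : realType) (n S : nat) (eps : R) (T : tester n S) : R :=
  sup [set decision_freq T H0 p | p in Theta n eps].

Definition has_tester (R : realType) (delta : R) (n : nat) (eps : R)
    (S : nat) : Prop :=
  exists T : tester n S, error_H0 R T <= delta /\ error_H1 eps T <= delta.

(* S = S^*(n, eps) for the error level delta. *)
Definition is_memory_complexity (R : realType) (delta : R) (n : nat) (eps : R)
    (S : nat) : Prop :=
  has_tester delta n eps S /\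
  forall S' : nat, has_tester delta n eps S' -> (S <= S')%N.

(* Main.v *)
(* The tester runs cycles of 2n tests, comparing p_i with p_0 and p_0 with p_i for
   every symbol i, and outputs the outcome of its last completed cycle: H1 as soon
   as one test rejects, H0 if none does. The length of a cycle is independent of
   the outcome of the previous one, so the asymptotic frequency of a decision is
   the probability that a single cycle ends with it.

   If p is at distance more than eps from uniform, then for some i the ratio of
   p_i and p_0 is at least 1 + eps/2, in one direction or the other. A test of the
   pair (up, dn) moves on the symbols up and dn only. It plays gambler's ruin on an
   interval of length 3a, with a of order 1/eps, starting at distance a from the
   lower end: under the uniform distribution it wins with probability 1/3, and if
   p_up >= (1 + eps/2) p_dn it wins with probability at least 2/3. A win or a loss
   raises or lowers a level by 1, and the test rejects when the level, started at a
   constant, gains log2 n + O(1) before reaching the bottom. Hence it rejects with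
   probability O(delta/n) under the uniform distribution, and in the biased case
   with probability at least 1 - delta. This makes O(n log n / eps) states.

   If p gives no mass to some symbol, the tests with that symbol as dn are never
   passed, so the initial decision H1 never changes. *)

Require Import Defs.
From HB Require Import structures.
From mathcomp Require Import all_boot all_order all_algebra.
From mathcomp Require Import all_classical all_reals all_analysis.
From mathcomp Require Import ring lra zify.

Set Implicit Arguments.
Unset Strict Implicit.
Unset Printing Implicit Defensive.

Import Order.TTheory GRing.Theory Num.Theory.
Import numFieldNormedType.Exports.

Local Open Scope ring_scope.

(** * Long-run frequencies from the Poisson equation *)

Lemma iid_prob0 (R : realType) (n : nat) (p : 'I_n -> R)
    (E : pred (0.-tuple 'I_n)) : iid_prob p E = (E [tuple])%:R.
Proof.
rewrite /iid_prob (eq_bigl (fun x => (x == [tuple]) && E [tuple])).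
  case: (E [tuple]); last by rewrite big_pred0 // => x; rewrite andbF.
  rewrite (big_pred1 [tuple]) ?big_ord0// => x; by rewrite andbT.
by move=> x; rewrite (tuple0 x) eqxx.
Qed.

Lemma iid_probS (R : realType) (n : nat) (p : 'I_n -> R) (t : nat)
    (E : pred (t.+1.-tuple 'I_n)) :
  iid_prob p E = \sum_a p a * iid_prob p (fun x => E [tuple of a :: x]).
Proof.
rewrite /iid_prob [RHS](eq_bigr (fun a => \sum_(x : t.-tuple 'I_n)
   if E [tuple of a :: x] then
   p a * \prod_(i < t) p (tnth x i) else 0)); last first.
  by move=> a _; rewrite mulr_sumr big_mkcond.
rewrite pair_big /= [LHS]big_mkcond /=.
rewrite (reindex (fun ax : 'I_n * t.-tuple 'I_n => [tuple of ax.1 :: ax.2])) /=.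
  apply: eq_bigr => -[a x] _ /=; case: ifP => // _.
  rewrite big_ord_recl; congr (_ * _).
  by apply: eq_bigr => i _; rewrite tnthS.
exists (fun x : t.+1.-tuple 'I_n => (thead x, [tuple of behead x])) => /=.
  by move=> [a x] _; congr pair; apply: val_inj.
by move=> x _; rewrite -tuple_eta.
Qed.

Definition visit_prob {R : realType} {n S : nat} (p : 'I_n -> R)
    (f : 'I_S -> 'I_n -> 'I_S) (D : pred 'I_S) (s : 'I_S) (t : nat) : R :=
  iid_prob p (fun x : t.-tuple 'I_n => D (foldl f s x)).

Lemma visit_prob0 (R : realType) (n S : nat) (p : 'I_n -> R)
    (f : 'I_S -> 'I_n -> 'I_S) (D : pred 'I_S) (s : 'I_S) :
  visit_prob p f D s 0 = (D s)%:R.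
Proof. exact: iid_prob0. Qed.

Lemma visit_probS (R : realType) (n S : nat) (p : 'I_n -> R)
    (f : 'I_S -> 'I_n -> 'I_S) (D : pred 'I_S) (s : 'I_S) (t : nat) :
  visit_prob p f D s t.+1 = \sum_a p a * visit_prob p f D (f s a) t.
Proof. exact: iid_probS. Qed.

(** With P the transition operator, 1_D = h + q - P h on the closed set [A]. Hence the sum of the
    P^i 1_D telescopes, and the quantity bounded is the mean of -h after [t] steps. *)
Lemma poisson_visits (R : realType) (n S : nat) (p : 'I_n -> R)
    (f : 'I_S -> 'I_n -> 'I_S) (D A : pred 'I_S) (h : 'I_S -> R) (q c : R) :
  is_distribution p ->
  (forall s a, A s -> p a != 0 -> A (f s a)) ->
  (forall s, A s -> h s + q = (D s)%:R + \sum_a p a * h (f s a)) ->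
  (forall s, `|h s| <= c) ->
  forall t s, A s ->
    `|\sum_(0 <= i < t) visit_prob p f D s i - h s - t%:R * q| <= c.
Proof.
move=> [p0 p1] Acl Ah hc; elim=> [|t IH] s As.
  by rewrite big_geq// mul0r subr0 sub0r normrN.
have -> : \sum_(0 <= i < t.+1) visit_prob p f D s i - h s - t.+1%:R * q =
    \sum_a p a * (\sum_(0 <= i < t) visit_prob p f D (f s a) i
                  - h (f s a) - t%:R * q).
  rewrite big_nat_recl// visit_prob0.
  under eq_bigr do rewrite visit_probS.
  rewrite exchange_big /=.
  under [RHS]eq_bigr do rewrite !mulrBr.
  rewrite !sumrB -[\sum_i p i * (t%:R * q)]mulr_suml p1 mul1r.
  under [in RHS]eq_bigr do rewrite mulr_sumr.
  have -> : h s = (D s)%:R + \sum_a p a * h (f s a) - q by rewrite -Ah// addrK.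
  rewrite -natr1; ring.
apply: le_trans (ler_norm_sum _ _ _) _.
rewrite -[leRHS]mul1r -[X in _ <= X * _]p1 mulr_suml; apply: ler_sum => a _.
rewrite normrM (ger0_norm (p0 a)).
have [->|pa] := eqVneq (p a) 0; first by rewrite !mul0r.
by apply: ler_wpM2l => //; apply: IH; exact: Acl.
Qed.

Lemma decision_freq_poisson (R : realType) (n S : nat) (T : tester n S)
    (p : 'I_n -> R) (H : hypothesis) (A : pred 'I_S) (h : 'I_S -> R) (q : R) :
  is_distribution p ->
  A (init_state T) ->
  (forall s a, A s -> p a != 0 -> A (transition T s a)) ->
  (forall s, A s -> h s + q =
     (decision T s == H)%:R + \sum_a p a * h (transition T s a)) ->
  decision_freq T H p = q.
Proof.
move=> pd A0 Acl Ah.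
pose c := \sum_s `|h s|.
have hc s : `|h s| <= c.
  by rewrite /c (bigD1 s)//= lerDl sumr_ge0.
pose D := [pred s | decision T s == H].
have Hp := poisson_visits (D := D) pd Acl Ah hc.
(* One [c] is the Poisson bound at time [t.+1]; the rest covers [h], [q] and the visit at time 0,
   which the average leaves out. *)
pose C := c + c + 1 + `|q|.
rewrite /decision_freq; apply/cvg_lim => //; apply/cvgrPdist_le => /= e e0.
near=> t.
have t0 : 0 < t%:R :> R by rewrite ltr0n; near: t; exact: nbhs_infty_gt.
rewrite -[X in X - _](mulKf (lt0r_neq0 t0)) -mulrBr normrM ger0_norm ?invr_ge0 ?ler0n//.
rewrite mulrC ler_pdivrMr//.
have Ce : C <= e * t%:R.
  rewrite -ler_pdivrMl// mulrC; near: t; exact: nbhs_infty_ger.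
apply: le_trans Ce.
rewrite big_add1 /=; set X := \sum_(0 <= i < t) _.
have := Hp t.+1 _ A0.
have -> : \sum_(0 <= i < t.+1) visit_prob p (transition T) D (init_state T) i =
    (D (init_state T))%:R + X by rewrite big_nat_recl// visit_prob0.
have := hc (init_state T).
set hs := h _; set b := (nat_of_bool _)%:R.
have : 0 <= b <= 1 by rewrite /b; case: (D _); rewrite /= ?lexx ?ler01.
rewrite -natr1 /C; move=> /andP[b0 b1] hs_c.
have -> : b + X - hs - (t%:R + 1) * q = - ((t%:R * q - X) - (b - hs - q)) by ring.
rewrite normrN => H1.
have -> : t%:R * q - X = (t%:R * q - X) - (b - hs - q) + (b - hs - q) by rewrite subrK.
apply: le_trans (ler_normD _ _) _.
have : `|b - hs - q| <= c + 1 + `|q|.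
  apply: le_trans (ler_normB _ _) _; rewrite lerD2r.
  apply: le_trans (ler_normB _ _) _; rewrite addrC lerD//.
  by rewrite ger0_norm.
by move: H1; lra.
Unshelve. all: by end_near.
Qed.

(** * Absorbing chains with two exits *)

Section AbsorbingChain.
Variables (R : realType) (n : nat) (p : 'I_n -> R) (X : finType).
Variable g : X -> 'I_n -> X + bool.
Hypothesis p_distr : is_distribution p.

Definition exit_value {Y : Type} (F : Y -> R) (e : bool -> R) (z : Y + bool) : R :=
  match z with inl y => F y | inr b => e b end.

Definition next_mean (F : X -> R) (e : bool -> R) (x : X) : R :=
  \sum_a p a * exit_value F e (g x a).

(** [rank] certifies that an exit can be reached from every state along symbols of positive
    probability. *)
Variable rank : X -> nat.
Hypothesis rank_decr : forall x, exists2 a, 0 < p a &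
  match g x a with inl y => (rank y < rank x)%N | inr _ => true end.

(* Among the minimizers of v take one of smallest rank: v takes the same value
   at all its successors, one of which has smaller rank. *)
Lemma absorbing_min_principle (v : X -> R) :
  (forall x, next_mean v (fun=> 0) x <= v x) -> forall x, 0 <= v x.
Proof.
move=> hv x; rewrite leNgt; apply/negP => vx.
case: (arg_minP v (erefl (xpredT x))) => x0 _ min0.
have m0 : v x0 < 0 by apply: le_lt_trans (min0 x isT) vx.
case: (@arg_minP _ _ _ x0 (fun y => v y == v x0) rank (eqxx _)) => y /eqP vy miny.
have [a pa] := rank_decr y.
have hz z : 0 <= exit_value v (fun=> 0) z - v x0.
  by case: z => [z|b] /=; rewrite subr_ge0 ?min0//; exact: ltW.
have [p0 p1] := p_distr.
have S0 : \sum_b p b * (exit_value v (fun=> 0) (g y b) - v x0) = 0.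
  apply/eqP; rewrite eq_le sumr_ge0 ?andbT; last by move=> b _; rewrite mulr_ge0.
  under eq_bigr do rewrite mulrBr.
  by rewrite sumrB -mulr_suml p1 mul1r subr_le0 -vy; exact: hv.
have /eqP : p a * (exit_value v (fun=> 0) (g y a) - v x0) = 0.
  apply/eqP; move/eqP: S0; rewrite psumr_eq0 => [/allP/(_ a)|b _]; last by rewrite mulr_ge0.
  by rewrite mem_index_enum => /(_ isT).
rewrite mulf_eq0 gt_eqF//= subr_eq0.
case: (g y a) => [z|b] /=; last by rewrite gt_eqF.
by move=> /miny; rewrite -Order.NatOrder.leEnat le_eqVlt leEnat; lia.
Qed.

(** The minimum principle for v and -v makes v - P v, with zero exit values, injective, hence
    surjective in finite dimension. The exit values [e] go into the source term. *)
Lemma absorbing_solution (e : bool -> R) (F0 : X -> R) :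
  exists F : X -> R, forall x, F x = F0 x + next_mean F e x.
Proof.
pose L (v : {ffun X -> R^o}) : {ffun X -> R^o} :=
  [ffun x => v x - next_mean v (fun=> 0) x].
have Llin : linear L.
  move=> k u v; apply/ffunP => x; rewrite !ffunE.
  have -> : next_mean (k *: u + v) (fun=> 0) x =
      k *: (next_mean u (fun=> 0) x : R^o) + next_mean v (fun=> 0) x.
    rewrite /next_mean scaler_sumr -big_split /=.
    apply: eq_bigr => a _; case: (g x a) => [y|b] /=; last first.
      by rewrite !mulr0 scaler0 addr0.
    by rewrite !ffunE mulrDr /GRing.scale /= mulrCA.
  by rewrite scalerBr opprD addrACA.
pose Lm := GRing.isLinear.Build _ _ _ _ L Llin.
pose Ll : {linear {ffun X -> R^o} -> {ffun X -> R^o}} := HB.pack L Lm.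
have kerL : lker (linfun Ll) == 0%VS.
  rewrite -subv0; apply/subvP => v; rewrite memv_ker memv0 lfunE /= => /eqP Lv.
  have Ev x : v x = next_mean v (fun=> 0) x.
    by have /ffunP/(_ x) : L v = 0 := Lv; rewrite !ffunE => /eqP; rewrite subr_eq0 => /eqP.
  apply/eqP/ffunP => x; rewrite ffunE; apply/eqP; rewrite eq_le; apply/andP; split.
    rewrite -oppr_ge0; move: x; apply: absorbing_min_principle => x.
    rewrite [in leRHS]Ev /next_mean -sumrN; apply: ler_sum => a _.
    by case: (g x a) => [y|b] /=; rewrite ?mulrN// !mulr0 oppr0.
  by move: x; apply: absorbing_min_principle => x; rewrite -Ev.
have : [ffun x => (F0 x + next_mean (fun=> 0) e x : R^o)] \in limg (linfun Ll).
  by rewrite lker0_limgf// memvf.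
move=> /memv_imgP[v _ Ev]; exists v => x.
have {}Ev : [ffun x => F0 x + next_mean (fun=> 0) e x] = L v by rewrite Ev lfunE.
have /ffunP/(_ x) := Ev; rewrite !ffunE => /eqP.
rewrite eq_sym subr_eq => /eqP ->; rewrite -addrA; congr (_ + _).
rewrite /next_mean -big_split /=; apply: eq_bigr => a _.
by case: (g x a) => [y|b] /=; rewrite mulr0 ?addr0 ?add0r.
Qed.

(** The minimum principle applies to [W - F], whose exit values are 0. *)
Lemma absorbing_comparison (e : bool -> R) (F W : X -> R) :
  (forall x, F x = next_mean F e x) -> (forall x, next_mean W e x <= W x) ->
  forall x, F x <= W x.
Proof.
move=> hF hW x; rewrite -subr_ge0; move: x; apply: absorbing_min_principle => x.
rewrite [in leRHS]hF lerBrDr; apply: le_trans (hW x).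
rewrite /next_mean -big_split /=; apply: ler_sum => a _; rewrite -mulrDr.
by case: (g x a) => [y|b] /=; rewrite ?subrK ?add0r.
Qed.

End AbsorbingChain.

(** * Testers that repeat an absorbing cycle *)

(* The states are pairs (d, x), where d is the outcome of the previous cycle and
   x the position within the current one. *)
Definition cycle_tester {n : nat} {X : finType} (g : X -> 'I_n -> X + bool) (x0 : X) :
    tester n #|{: bool * X}| :=
  Tester (enum_rank (H1, x0))
    (fun s a => let: (d, x) := enum_val s in
       enum_rank (match g x a with inl y => (d, y) | inr b => (b, x0) end))
    (fun s => (enum_val s).1).

(* A renewal-reward argument: the outcome of a cycle is independent of the length
   of the next one. With T the expected remaining length of the cycle and F the
   probability that it ends with outcome H, the function
   (1[d = H] - F x0) T x + T x0 F x solves the Poisson equation. *)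
Lemma cycle_tester_freq (R : realType) (n : nat) (X : finType)
    (g : X -> 'I_n -> X + bool) (x0 : X) (p : 'I_n -> R) (H : hypothesis)
    (rank : X -> nat) (W : X -> R) :
  is_distribution p ->
  (forall x, exists2 a, 0 < p a &
     match g x a with inl y => (rank y < rank x)%N | inr _ => true end) ->
  (forall x, next_mean p g W (fun b => (b == H)%:R) x <= W x) ->
  decision_freq (cycle_tester g x0) H p <= W x0.
Proof.
move=> pd hr hW.
have [T ET] := absorbing_solution pd hr (fun=> 0) (fun=> 1).
have [F EF] := absorbing_solution pd hr (fun b => (b == H)%:R) (fun=> 0).
have {}EF x : F x = next_mean p g F (fun b => (b == H)%:R) x.
  by rewrite EF add0r.
apply: le_trans (absorbing_comparison pd hr EF hW x0).
pose h (s : 'I_#|{: bool * X}|) : R := let: (d, x) := enum_val s in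
  ((d == H)%:R - F x0) * T x + T x0 * F x.
rewrite le_eqVlt; apply/orP; left; apply/eqP.
apply: (decision_freq_poisson (A := xpredT) (h := h)) => // s _ /=.
rewrite /h; case Es : (enum_val s) => [d x] /=.
have -> : \sum_a p a * (let: (d0, x1) := enum_val (enum_rank
      match g x a with inl y => (d, y) | inr b => (b, x0) end) in
      ((d0 == H)%:R - F x0) * T x1 + T x0 * F x1) =
   ((d == H)%:R - F x0) * next_mean p g T (fun=> 0) x +
   T x0 * next_mean p g F (fun b => (b == H)%:R) x.
  rewrite /next_mean !mulr_sumr -big_split /=; apply: eq_bigr => a _.
  by rewrite enum_rankK; case: (g x a) => [y|b] /=; ring.
rewrite -EF [in LHS]ET; ring.
Qed.

(** * The nested walk within a cycle *)

(* In the position (k, j, s), k counts the tests that remain after the current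
   one, which moves down on the symbol dn k and up on the symbol up k. Indices
   start from 0: the levels j = 0, ..., G lie between the absorbing ends -1 and
   G.+1, and within a level s = 0, ..., 3a+1 lies between the ends -1 and 3a+2,
   at distances a.+1 and 2a.+2 from the start s = a. *)
Definition walk_down (g0 a : nat) (x : nat * nat * nat) : nat * nat * nat + bool :=
  match x with
  | (k, j, s.+1) => inl (k, j, s)
  | (k, j.+1, 0) => inl (k, j, a)
  | (k.+1, 0, 0) => inl (k, g0, a)
  | (0, 0, 0) => inr H0
  end.

Lemma walk_downS (g0 a k j s : nat) : walk_down g0 a (k, j, s.+1) = inl (k, j, s).
Proof. by case: k; case: j. Qed.

Lemma walk_down0S (g0 a k j : nat) : walk_down g0 a (k, j.+1, 0%N) = inl (k, j, a).
Proof. by case: k. Qed.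

Definition walk_up (G a : nat) (x : nat * nat * nat) : nat * nat * nat + bool :=
  let: (k, j, s) := x in
  if (s < (3 * a).+1)%N then inl (k, j, s.+1)
  else if (j < G)%N then inl (k, j.+1, a) else inr H1.

Section Walk.
Variables (n K G g0 a : nat) (up dn : nat -> 'I_n).
Hypothesis g0_le : (g0 <= G)%N.

Definition position : finType := ('I_K.+1 * 'I_G.+1 * 'I_(3 * a).+2)%type.

Definition coords (x : position) : nat * nat * nat :=
  (nat_of_ord x.1.1, nat_of_ord x.1.2, nat_of_ord x.2).

(** The moves are defined on natural numbers, where their arithmetic is plain; [inord] never
    truncates here, since both moves stay in range. *)
Definition to_position (z : nat * nat * nat + bool) : position + bool :=
  match z with
  | inl (k, j, s) => inl (inord k, inord j, inord s)
  | inr b => inr b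
  end.

(** [dn] is examined first, so a test of a symbol against itself only moves down. *)
Definition walk_step (x : position) (c : 'I_n) : position + bool :=
  if c == dn x.1.1 then to_position (walk_down g0 a (coords x))
  else if c == up x.1.1 then to_position (walk_up G a (coords x))
  else inl x.

Definition walk_start : position := (inord K, inord g0, inord a).

Definition in_range (x : nat * nat * nat) : bool :=
  [&& (x.1.1 <= K)%N, (x.1.2 <= G)%N & (x.2 <= (3 * a).+1)%N].

Lemma in_range_coords (x : position) : in_range (coords x).
Proof. by apply/and3P; split; exact: leq_ord. Qed.

Lemma coords_inord (k j s : nat) : in_range (k, j, s) ->
  coords (inord k, inord j, inord s) = (k, j, s).
Proof. by case/and3P => /= *; rewrite /coords /= !inordK. Qed.

Lemma walk_down_in_range x y : in_range x -> walk_down g0 a x = inl y -> in_range y.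
Proof.
by case: x => [[[|k] [|j]] [|s]] /and3P[/= ? ? ?] //= -[<-]; apply/and3P; split => /=; lia.
Qed.

Lemma walk_up_in_range x y : in_range x -> walk_up G a x = inl y -> in_range y.
Proof.
case: x => [[k j] s] /and3P[/= ? ? ?].
by case: ifP => ?; [|case: ifP => // ?]; move=> [<-]; apply/and3P; split => /=; lia.
Qed.

Lemma coords_walk_down (x y : position) :
  to_position (walk_down g0 a (coords x)) = inl y ->
  walk_down g0 a (coords x) = inl (coords y).
Proof.
case E : (walk_down g0 a (coords x)) => [[[k j] s]|] //= [<-].
by rewrite coords_inord//; apply: walk_down_in_range E; exact: in_range_coords.
Qed.

Variables (R : realType) (p : 'I_n -> R).
Hypothesis p_distr : is_distribution p.

Lemma exit_value_down (w : nat * nat * nat -> R) (e : bool -> R) (x : position) :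
  exit_value (w \o coords) e (to_position (walk_down g0 a (coords x))) =
  exit_value w e (walk_down g0 a (coords x)).
Proof.
case E : (walk_down g0 a (coords x)) => [[[k j] s]|] //=.
by rewrite coords_inord//; apply: walk_down_in_range E; exact: in_range_coords.
Qed.

Lemma exit_value_up (w : nat * nat * nat -> R) (e : bool -> R) (x : position) :
  exit_value (w \o coords) e (to_position (walk_up G a (coords x))) =
  exit_value w e (walk_up G a (coords x)).
Proof.
case E : (walk_up G a (coords x)) => [[[k j] s]|] //=.
by rewrite coords_inord//; apply: walk_up_in_range E; exact: in_range_coords.
Qed.

(** The condition is on the drift of [w]: all symbols other than [up k] and [dn k] leave the
    position fixed and cancel. *)
Lemma walk_supersolution (w : nat * nat * nat -> R) (e : bool -> R) :
  (forall k j s, (k <= K)%N -> (j <= G)%N -> (s <= (3 * a).+1)%N ->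
     p (dn k) * (exit_value w e (walk_down g0 a (k, j, s)) - w (k, j, s)) +
     (if up k == dn k then 0
      else p (up k) * (exit_value w e (walk_up G a (k, j, s)) - w (k, j, s))) <= 0) ->
  forall x, next_mean p walk_step (w \o coords) e x <= (w \o coords) x.
Proof.
move=> hw x; have [p0 p1] := p_distr.
have /and3P[kK jG sa] := in_range_coords x.
rewrite -subr_le0; apply: le_trans (hw _ _ _ kK jG sa).
rewrite -[X in _ - X]mul1r -[X in _ - X * _]p1 mulr_suml -sumrB /=.
under eq_bigr do rewrite -mulrBr /walk_step.
rewrite (bigD1 (dn x.1.1))//= eqxx exit_value_down lerD2l.
case: eqVneq => [ud|ud].
  rewrite big1// => c cd; rewrite (negbTE cd) ud (negbTE cd) /=.
  by rewrite subrr mulr0.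
rewrite (bigD1 (up x.1.1))//= (negbTE ud) eqxx exit_value_up.
rewrite big1 ?addr0// => c /andP[cd cu]; rewrite (negbTE cd) (negbTE cu) /=.
by rewrite subrr mulr0.
Qed.

Lemma walk_freq_le (H : hypothesis) (w : nat * nat * nat -> R) :
  (forall k, 0 < p (dn k)) ->
  let e := fun b : bool => (b == H)%:R in
  (forall k j s, (k <= K)%N -> (j <= G)%N -> (s <= (3 * a).+1)%N ->
     p (dn k) * (exit_value w e (walk_down g0 a (k, j, s)) - w (k, j, s)) +
     (if up k == dn k then 0
      else p (up k) * (exit_value w e (walk_up G a (k, j, s)) - w (k, j, s))) <= 0) ->
  decision_freq (cycle_tester walk_step walk_start) H p <= w (K, g0, a).
Proof.
move=> pdn e hw.
rewrite -(@coords_inord K g0 a); last by apply/and3P; split => //=; lia.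
(* Lexicographic index of (k, j, s): every move down lowers it. *)
pose rank (x : position) := let: (k, j, s) := coords x in
  ((k * G.+1 + j) * (3 * a).+2 + s)%N.
apply: (@cycle_tester_freq _ _ _ _ walk_start _ _ rank (w \o coords)) => //.
  move=> x; exists (dn x.1.1) => //; rewrite /walk_step eqxx.
  case E : (to_position _) => [y|] //; have := coords_walk_down E.
  rewrite /rank; have /and3P[] := in_range_coords y.
  case: (coords y) (coords x) => [[k' j'] s'] [[[|k] [|j]] [|s]] /= _ j'G s'a //;
    move=> -[? ? ?]; subst; nia.
move=> x; exact: walk_supersolution.
Qed.

(** The states with decision [H1] and k >= k0 form a closed set: test [k0] is never passed, and an
    exit with [H1] restarts at [K]. On this set h = 0 and q = 0 solve the Poisson equation. *)
Lemma walk_freq_missing_symbol (k0 : nat) : (k0 <= K)%N -> p (dn k0) = 0 ->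
  decision_freq (cycle_tester walk_step walk_start) H0 p = 0.
Proof.
move=> k0K pk0.
pose A (s : 'I_#|{: bool * position}|) :=
  (enum_val s).1 && (k0 <= (enum_val s).2.1.1)%N.
apply: (@decision_freq_poisson _ _ _ _ _ _ A (fun=> 0)) => //.
- by rewrite /A /= enum_rankK /= inordK.
- move=> s c; rewrite /A /=; case: (enum_val s) => [d x] /= /andP[-> k0x] pc.
  rewrite enum_rankK /walk_step; case: eqP => [cd|_].
    have k0x' : k0 != x.1.1 by apply: contraNneq pc => Ek; rewrite cd -Ek pk0.
    case E : (to_position _) => [y|b] /=.
      move/coords_walk_down: E; rewrite /coords.
      case: (x.1.1 : nat) k0x k0x' => [|k] ? ?;
        case: (x.1.2 : nat) => [|j]; case: (x.2 : nat) => [|s'] //= -[<- _ _]; lia.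
    move: E; rewrite /coords.
    case: (x.1.1 : nat) k0x k0x' => [|k] k0x k0x'; first by lia.
    by case: (x.1.2 : nat) => [|j]; case: (x.2 : nat).
  case: eqP => [_|_] //=; case E : (to_position _) => [y|b] /=; move: E; rewrite /walk_up /=.
    by case: ifP => _; [|case: ifP => // _] => -[<-] /=; rewrite inordK.
  by case: ifP => // _; case: ifP => // _ [<-]; rewrite /= inordK.
- move=> s /andP[sd _]; rewrite /= sd; under eq_bigr do rewrite mulr0.
  by rewrite big1// !addr0.
Qed.

End Walk.

(** * Error bounds from explicit supersolutions *)

Lemma uniform_is_distribution (R : realType) (n : nat) :
  is_distribution (uniform_distribution R n.+1).
Proof.
split=> [i|]; first by rewrite /uniform_distribution invr_ge0.
by rewrite sumr_const card_ord -[RHS](mulVf (lt0r_neq0 (ltr0Sn R n))) mulr_natr.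
Qed.

(* The supersolution w is 2^(j-G-1) at the start of level j of the current test and
   affine in s within the level, which matches the odds 1/3 and 2/3 of the fair
   walk; k * eta is a union bound over the remaining tests. *)
Lemma walk_freq_uniform (R : realType) (n K G g0 a : nat) (up dn : nat -> 'I_n.+1) :
  (g0 <= G)%N ->
  decision_freq (cycle_tester (walk_step g0 up dn) (walk_start K G g0 a)) H1
    (uniform_distribution R n.+1) <= K.+1%:R * (2 ^+ g0 / 2 ^+ G.+1).
Proof.
move=> g0G; pose eta : R := 2 ^+ g0 / 2 ^+ G.+1.
pose A : R := a.+1%:R.
have A0 : 0 < A by rewrite /A ltr0Sn.
have eta0 : 0 <= eta by rewrite /eta divr_ge0// exprn_ge0.
pose w (x : nat * nat * nat) : R := let: (k, j, s) := x in
  2 ^+ j / 2 ^+ G.+1 * (2^-1 + s.+1%:R / (2 * A)) + k%:R * eta.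
have wstart k j : w (k, j, a) = 2 ^+ j / 2 ^+ G.+1 + k%:R * eta.
  by rewrite /w -/A; congr (_ + _); field; rewrite nat1r pnatr_eq0 expf_neq0.
have -> : K.+1%:R * (2 ^+ g0 / 2 ^+ G.+1) = w (K, g0, a).
  by rewrite wstart -/eta -natr1; ring.
apply: walk_freq_le => // [|k|].
- exact: uniform_is_distribution.
- by rewrite /uniform_distribution invr_gt0.
move=> k j s kK jG sa; set e := (fun b => _).
set z : R := 2 ^+ j / 2 ^+ G.+1.
have z0 : 0 <= z by rewrite /z divr_ge0// exprn_ge0.
set y := s%:R / (2 * A).
pose d := (2 * A)^-1.
have d0 : 0 <= d by rewrite /d invr_ge0 mulr_ge0// ltW.
have y0 : 0 <= y by rewrite /y divr_ge0// mulr_ge0// ltW.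
have zd0 : 0 <= z * d by rewrite mulr_ge0.
have keta : 0 <= k%:R * eta by rewrite mulr_ge0.
have Ew : w (k, j, s) = z * (2^-1 + (y + d)) + k%:R * eta.
  by rewrite /w -/z -[s.+1%:R]natr1 mulrDl mul1r.
have Dle : exit_value w e (walk_down g0 a (k, j, s)) <=
    z * (2^-1 + y) + k%:R * eta.
  case: s sa @y y0 Ew => [|s] sa y y0 Ew; last first.
    by rewrite walk_downS.
  case: j jG @z z0 zd0 Ew => [|j] jG z z0 zd0 Ew; last first.
    rewrite walk_down0S [exit_value _ _ _]wstart /y mul0r addr0 lerD2r.
    have -> : z * 2^-1 = 2 ^+ j / 2 ^+ G.+1 by rewrite /z exprS; field; rewrite expf_neq0.
    exact: lexx.
  have zy : 0 <= z * (2^-1 + y) by rewrite mulr_ge0// addr_ge0// invr_ge0.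
  case: k kK keta Ew => [|k] kK keta Ew; first by rewrite /= mul0r addr0.
  by rewrite [exit_value _ _ _]wstart -/eta -[k.+1%:R]natr1 mulrDl mul1r addrC lerDr.
have Ule : exit_value w e (walk_up G a (k, j, s)) <=
    z * (2^-1 + (y + d + d)) + k%:R * eta.
  rewrite /walk_up; case: ifP => sa'.
    suff -> : y + d + d = s.+2%:R / (2 * A) by [].
    by rewrite /y /d -[s.+2%:R]natr1 -[s.+1%:R]natr1; ring.
  (* At the upper end the affine profile reaches 2z, the value at the start of level [j.+1], or 1
     when j = G. *)
  have Es : y + d + d = 3 / 2.
    rewrite /y /d; have -> : s = (3 * a).+1 by lia.
    rewrite -[(3 * a).+1%:R]natr1 natrM /A -[a.+1%:R]natr1; field.
    by rewrite natr1 pnatr_eq0.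
  rewrite Es; have -> : z * (2^-1 + 3 / 2) = 2 ^+ j.+1 / 2 ^+ G.+1.
    by rewrite exprS /z; field; rewrite expf_neq0.
  case: ifP => jG'; first by rewrite [exit_value _ _ _]wstart.
  have -> : j = G by lia.
  by rewrite divff ?expf_neq0//= lerDl.
rewrite /uniform_distribution; set c := n.+1%:R^-1.
have c0 : 0 <= c by rewrite /c invr_ge0.
case: ifP => _; rewrite ?addr0 -?mulrDr pmulr_rle0 ?invr_gt0 ?ltr0Sn// Ew; lra.
Qed.

(* Within test k0 the supersolution is at most 2^-(j+1) at the start of level j and
   affine in r^s, a supermartingale of the biased walk. *)
Lemma walk_freq_biased (R : realType) (n K G g0 a k0 : nat) (up dn : nat -> 'I_n)
    (p : 'I_n -> R) (r delta : R) :
  (g0 <= G)%N -> is_distribution p -> (forall i, 0 < p i) -> (k0 <= K)%N ->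
  0 < r -> r < 1 -> p (dn k0) <= r * p (up k0) -> r ^+ a.+1 <= 3^-1 ->
  2 ^- g0.+1 <= delta ->
  decision_freq (cycle_tester (walk_step g0 up dn) (walk_start K G g0 a)) H0 p
    <= delta.
Proof.
move=> g0G pd p0 k0K r0 r1 pr ra gd.
(* The bracket is 2 at the lower end s = -1, at most 1 at the start s = a because of [ra], and at
   least 1/2 at the upper end, as the factor 2 between levels demands. *)
pose v (j s : nat) : R := 2 ^- j.+1 * (2^-1 + 3 / 2 * r ^+ s.+1).
have v0 j s : 0 <= v j s.
  by rewrite mulr_ge0 ?invr_ge0 ?exprn_ge0// addr_ge0 ?mulr_ge0 ?exprn_ge0 ?invr_ge0// ltW.
have va j : v j a <= 2 ^- j.+1.
  rewrite /v ler_piMr ?invr_ge0 ?exprn_ge0//; lra.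
have delta0 : 0 <= delta by apply: le_trans gd; rewrite invr_ge0 exprn_ge0.
(* Since k counts down, k > k0 means that test [k0] is still to come; once it has been passed, the
   trivial bound 1 is used. *)
pose w (x : nat * nat * nat) : R := let: (k, j, s) := x in
  if (k0 < k)%N then delta else if k == k0 then v j s else 1.
have wstart : w (K, g0, a) <= delta.
  rewrite /w; case: ifP => // k0K'; have -> : K == k0 by lia.
  exact: le_trans (va _) gd.
apply: le_trans wstart; apply: walk_freq_le => // k j s kK jG sa; set e := (fun b => _).
have [k0k|kk0|Ek] := ltngtP k0 k.
- have Dle : exit_value w e (walk_down g0 a (k, j, s)) <= delta.
    case: s sa => [|s] sa; last by rewrite walk_downS /= k0k.
    case: j jG => [|j] jG; last by rewrite walk_down0S /= k0k.
    case: k kK k0k => [|k] kK k0k //=; case: ifP => // k0k'.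
    have -> : k == k0 by lia.
    exact: le_trans (va _) gd.
  have Ule : exit_value w e (walk_up G a (k, j, s)) <= delta.
    by rewrite /walk_up; case: ifP => _; [rewrite /= k0k|case: ifP => _; rewrite /= ?k0k].
  have -> : w (k, j, s) = delta by rewrite /w k0k.
  rewrite -[leRHS]addr0 lerD//; first by rewrite pmulr_rle0// subr_le0.
  by case: ifP => // _; rewrite pmulr_rle0// subr_le0.
- have w1 j' s' : w (k, j', s') = 1.
    by rewrite /w ltnNge (ltnW kk0) /= ltn_eqF.
  have Dle : exit_value w e (walk_down g0 a (k, j, s)) <= 1.
    case: s sa => [|s] sa; last by rewrite walk_downS [exit_value _ _ _]w1.
    case: j jG => [|j] jG; last first.
      by rewrite walk_down0S [exit_value _ _ _]w1.
    case: k kK kk0 {w1} => [|k] kK kk0 //=.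
    by rewrite ltnNge ltnW ?(ltn_trans _ kk0)//= ltn_eqF// (ltn_trans _ kk0).
  have Ule : exit_value w e (walk_up G a (k, j, s)) <= 1.
    rewrite /walk_up; case: ifP => _; first by rewrite [exit_value _ _ _]w1.
    by case: ifP => _; [rewrite [exit_value _ _ _]w1|].
  rewrite w1 -[leRHS]addr0 lerD//.
    by rewrite pmulr_rle0// subr_le0.
  by case: ifP => // _; rewrite pmulr_rle0// subr_le0.
have wv j' s' : w (k0, j', s') = v j' s' by rewrite /w ltnn eqxx.
pose z : R := 2 ^- j.+1.
have z0 : 0 <= z by rewrite /z invr_ge0 exprn_ge0.
have Dle : exit_value w e (walk_down g0 a (k0, j, s)) <=
    z * (2^-1 + 3 / 2 * r ^+ s).
  case: s sa => [|s] sa.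
    have -> : z * (2^-1 + 3 / 2 * r ^+ 0) = 2 ^- j.
      by rewrite /z exprS expr0; field; rewrite expf_neq0.
    case: j jG @z z0 => [|j] jG z z0; last first.
      by rewrite walk_down0S [exit_value _ _ _]wv.
    rewrite expr0 invr1; case Ek0 : (k0) => [|k'] //.
    have -> : walk_down g0 a (k'.+1, 0, 0)%N = inl (k', g0, a) by [].
    by rewrite /= !ifF// Ek0; lia.
  by rewrite walk_downS [exit_value _ _ _]wv.
have Ule : exit_value w e (walk_up G a (k0, j, s)) <=
    z * (2^-1 + 3 / 2 * r ^+ s.+2).
  have nn : 0 <= r ^+ s.+2 by rewrite exprn_ge0// ltW.
  rewrite /walk_up; case: ifP => _; first by rewrite [exit_value _ _ _]wv.
  case: ifP => _; last by rewrite /= mulr_ge0//; lra.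
  rewrite [exit_value _ _ _]wv; apply: le_trans (va _) _.
  have -> : 2 ^- j.+2 = z * 2^-1 :> R by rewrite /z exprSr invfM mulrC.
  by rewrite ler_wpM2l//; lra.
rewrite -Ek wv; case: eqP => [ud|_].
  by move: pr; rewrite ud leNgt gtr_pMl// r1.
apply: le_trans (_ : p (dn k0) * (z * (2^-1 + 3 / 2 * r ^+ s) - v j s) +
   p (up k0) * (z * (2^-1 + 3 / 2 * r ^+ s.+2) - v j s) <= 0).
  by rewrite lerD// ler_pM2l// lerD2r.
(* Both increments of r^s are multiples of 1 - r, so the sign of the drift is that of p_dn - r
   p_up. *)
have -> : p (dn k0) * (z * (2^-1 + 3 / 2 * r ^+ s) - v j s) +
   p (up k0) * (z * (2^-1 + 3 / 2 * r ^+ s.+2) - v j s) =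
   (z * (3 / 2) * r ^+ s * (1 - r)) * (p (dn k0) - r * p (up k0)).
  by rewrite /v -/z !exprS; ring.
rewrite mulr_ge0_le0 ?subr_le0// !mulr_ge0 ?exprn_ge0 ?subr_ge0 ?invr_ge0// ltW//.
Qed.

(** * From distance to a biased pair, and the list of tests *)

(** If all ratios to p_0 lie within 1 + eps/2, averaging over i gives u <= (1 + eps/2) p_0, hence
    p_i >= (1 - eps) u for every i, and the distance is at most eps. *)
Lemma Theta_ratio (R : realType) (n : nat) (eps : R) (p : 'I_n.+1 -> R) :
  0 < eps -> Theta n.+1 eps p ->
  exists i, (1 + eps / 2) * p ord0 <= p i \/ (1 + eps / 2) * p i <= p ord0.
Proof.
move=> e0 [[p0 p1] far]; apply: contrapT => /forallNP H.
have {}H i : p i < (1 + eps / 2) * p ord0 /\ p ord0 < (1 + eps / 2) * p i.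
  by have := H i; move/not_orP => [/negP ? /negP ?]; rewrite !ltNge.
move: far; apply/negP; rewrite -leNgt /dTV /uniform_distribution.
set u := n.+1%:R^-1.
have u0 : 0 < u by rewrite invr_gt0 ltr0Sn.
have su : \sum_(i < n.+1) u = 1 := (uniform_is_distribution R n).2.
have pu : u <= (1 + eps / 2) * p ord0.
  rewrite -[u]mulr1 /u ler_pdivrMl ?ltr0Sn// -[leLHS]p1.
  apply: le_trans (ler_sum _ (fun i _ => ltW (H i).1)) _.
  by rewrite sumr_const card_ord mulr_natl.
have up i : u - p i <= eps * u.
  have [h1 h2] := H i; have pi0 := p0 i.
  have h3 : u <= (1 + eps / 2) * ((1 + eps / 2) * p i).
    by apply: le_trans pu _; rewrite ler_pM2l ?ltW//; lra.
  have [e1|e1] := leP 1 eps.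
    by apply: (@le_trans _ _ u); rewrite ?gerBl// ler_peMl// ltW.
  rewrite lerBlDr -lerBlDl -[X in X - _]mul1r -mulrBl.
  apply: le_trans (_ : (1 - eps) * ((1 + eps / 2) * ((1 + eps / 2) * p i)) <= _).
    by rewrite ler_pM2l ?subr_gt0.
  rewrite -subr_ge0.
  have -> : p i - (1 - eps) * ((1 + eps / 2) * ((1 + eps / 2) * p i)) =
    eps ^+ 2 * (3 / 4 + eps / 4) * p i by field.
  by rewrite !mulr_ge0 ?addr_ge0 ?mulr_ge0 ?invr_ge0 ?exprn_ge0// ltW.
(* |x| is x plus twice its negative part, here at most eps u; the terms p_i - u sum to 0. *)
apply: (@le_trans _ _ (2^-1 * \sum_(i < n.+1) ((p i - u) + 2 * (eps * u)))).
  rewrite ler_pM2l ?invr_gt0//; apply: ler_sum => i _.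
  have := up i; have : 0 <= eps * u by rewrite mulr_ge0 ?ltW.
  by case: (ger0P (p i - u)) => ?; lra.
by rewrite big_split /= sumrB p1 su subrr add0r -!mulr_sumr su mulr1 mulKf.
Qed.

Definition test_up (n : nat) (k : nat) : 'I_n.+1 :=
  if (k < n.+1)%N then inord k else ord0.
Definition test_dn (n : nat) (k : nat) : 'I_n.+1 :=
  if (k < n.+1)%N then ord0 else inord (k - n.+1).

(** Besides the case of p_0 dominating p_i, this supplies the test that a symbol of mass 0
    blocks. *)
Lemma test_dn_surj (n : nat) (i : 'I_n.+1) :
  exists2 k, (k <= (n.+1 + n.+1).-1)%N & test_dn n k = i /\ test_up n k = ord0.
Proof.
exists (n.+1 + i)%N; first by have := ltn_ord i; lia.
rewrite /test_dn /test_up ltnNge leq_addr /= addKn.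
by split=> //; apply: val_inj; rewrite /= inordK.
Qed.

Lemma test_up_surj (n : nat) (i : 'I_n.+1) :
  exists2 k, (k <= (n.+1 + n.+1).-1)%N & test_dn n k = ord0 /\ test_up n k = i.
Proof.
exists (i : nat); first by have := ltn_ord i; lia.
rewrite /test_dn /test_up ltn_ord.
by split=> //; apply: val_inj; rewrite /= inordK.
Qed.

Lemma walk_has_tester (R : realType) (n G g0 a : nat) (delta eps : R) :
  (g0 <= G)%N -> 0 < eps -> 2 ^- g0.+1 <= delta ->
  (n.+1 + n.+1)%:R * (2 ^+ g0 / 2 ^+ G.+1) <= delta ->
  3 <= (1 + eps / 2) ^+ a.+1 ->
  has_tester delta n.+1 eps #|{: bool * position (n.+1 + n.+1).-1 G a}|.
Proof.
move=> g0G e0 gd Gd ae.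
have delta0 : 0 <= delta by apply: le_trans gd; rewrite invr_ge0 exprn_ge0.
set K := (n.+1 + n.+1).-1.
exists (cycle_tester (walk_step g0 (test_up n) (test_dn n)) (walk_start K G g0 a)).
split.
  by apply: le_trans (walk_freq_uniform _ _ _ _ _ _) Gd.
(* For empty [Theta] the error is 0 by convention; [ge_sup] needs a nonempty set. *)
rewrite /error_H1; have [Th0|/set0P Thn0] := eqVneq (Theta n.+1 eps) set0.
  by rewrite Th0 image_set0 sup0.
apply: ge_sup; first by case: Thn0 => p Tp; exists (decision_freq
   (cycle_tester (walk_step g0 (test_up n) (test_dn n)) (walk_start K G g0 a)) H0 p), p.
move=> _ [p Tp <-]; have pd := Tp.1; have p_ge0 := pd.1.
have [[i pi0]|pn0] := pselect (exists i, p i = 0).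
  have [k kK [Ek _]] := test_dn_surj i.
  by rewrite (walk_freq_missing_symbol _ _ g0G pd kK) ?Ek.
have p_gt0 i : 0 < p i.
  by rewrite lt_def p_ge0 andbT; apply/eqP => pi0; apply: pn0; exists i.
have c0 : 0 < 1 + eps / 2 by rewrite addr_gt0// divr_gt0.
have [k kK pk] : exists2 k, (k <= K)%N &
    p (test_dn n k) <= (1 + eps / 2)^-1 * p (test_up n k).
  have [i [h|h]] := Theta_ratio e0 Tp.
    by have [k kK [E1 E2]] := test_up_surj i; exists k; rewrite // E1 E2 ler_pdivlMl.
  by have [k kK [E1 E2]] := test_dn_surj i; exists k; rewrite // E1 E2 ler_pdivlMl.
apply: (walk_freq_biased g0G pd p_gt0 kK _ _ pk) => //.
- by rewrite invr_gt0.
- by rewrite invf_lt1// ltrDl divr_gt0.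
- by rewrite exprVn lef_pV2 ?posrE ?exprn_gt0.
Qed.

(** * Choice of parameters and count of states *)

Lemma has_tester_is_memory_complexity (R : realType) (delta eps : R) (n S : nat) :
  has_tester delta n eps S ->
  exists2 S', is_memory_complexity delta n eps S' & (S' <= S)%N.
Proof.
move=> hS; have exS : exists S', `[< has_tester delta n eps S' >].
  by exists S; apply/asboolP.
case: (ex_minnP exS) => S' /asboolP hS' minS'; exists S'; last exact/minS'/asboolP.
by split=> // S'' hS''; apply/minS'/asboolP.
Qed.

Lemma trunc_log_le_ln (R : realType) (n : nat) :
  (trunc_log 2 n.+1)%:R * ln 2 <= ln n.+1%:R :> R.
Proof.
rewrite mulr_natl -lnXn// ler_ln ?posrE ?exprn_gt0 ?ltr0Sn// -natrX ler_nat.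
exact: trunc_logP.
Qed.

Lemma bernoulli_inequality (R : realDomainType) (x : R) (m : nat) :
  0 <= x -> 1 + x *+ m <= (1 + x) ^+ m.
Proof.
move=> x0; elim: m => [|m IH]; first by rewrite mulr0n addr0 expr0.
apply: le_trans (_ : (1 + x) * (1 + x *+ m) <= _); last first.
  by rewrite exprS ler_wpM2l// addr_ge0.
have : 0 <= x * (x *+ m) by rewrite mulr_ge0// mulrn_wge0.
rewrite mulrSr; set y := x *+ m; nra.
Qed.

Theorem theorem1 (R : realType) (delta : R)
    (delta_gt0 : 0 < delta) (delta_lt_half : delta < 1 / 2) :
  exists C : R, forall (n : nat) (eps : R),
    (2 <= n)%N -> 0 < eps -> eps < 1 ->
    exists S : nat, is_memory_complexity delta n eps S /\
      S%:R <= C * (n%:R * ln (n%:R : R) / eps).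
Proof.
(* Then 2^(g0+1) > g0 + 1 > 1/delta. *)
pose g0 := Num.truncn delta^-1.
have hg : 2 ^- g0.+1 <= delta.
  rewrite -[leRHS]invrK lef_pV2 ?posrE ?invr_gt0 ?exprn_gt0//.
  apply: le_trans (ltW (truncnS_gt _)) _.
  by rewrite -natrX ler_nat ltnW// ltn_expl.
have ln2_gt0 : 0 < ln 2 :> R by rewrite ln_gt0// ltr1n.
(* 56 = 2 * 2 * 14: two decisions, two tests per symbol, and levels of length at most 14/eps. From
   here on there are [n.+1] symbols. *)
exists (56 * (2 * g0 + 4)%:R / ln 2) => -[//|n] eps n2 eps0 eps1.
(* With a + 1 > 4/eps, Bernoulli's inequality gives (1 + eps/2)^(a+1) >= 1 + 2. *)
pose a := Num.truncn (4 / eps).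
(* Chosen so that the union bound over all tests is at most 2^-(g0+1). *)
pose G := (trunc_log 2 n.+1 + 2 * g0 + 2)%N.
have g0G : (g0 <= G)%N by rewrite /G; lia.
have hG : (n.+1 + n.+1)%:R * (2 ^+ g0 / 2 ^+ G.+1) <= delta.
  have -> : (2 ^+ G.+1 : R) =
      2 ^+ g0 * (2 ^+ g0.+1 * (2 * 2 ^+ (trunc_log 2 n.+1).+1)).
    by rewrite -exprS -!exprD; congr (_ ^+ _); rewrite /G; lia.
  set P := 2 ^+ g0; set Q := 2 ^+ g0.+1 in hg *; set L := 2 ^+ (trunc_log 2 n.+1).+1.
  have L0 : 0 < L :> R by rewrite exprn_gt0.
  rewrite natrD.
  have -> : (n.+1%:R + n.+1%:R) * (P / (P * (Q * (2 * L)))) = Q^-1 * (n.+1%:R / L).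
    by field; rewrite !expf_neq0.
  apply: le_trans hg; rewrite ler_piMr ?invr_ge0 ?exprn_ge0//.
  by rewrite ler_pdivrMr// mul1r /L -natrX ler_nat ltnW// trunc_log_ltn.
have ha : 3 <= (1 + eps / 2) ^+ a.+1.
  have ae : 4 <= eps * a.+1%:R.
    by rewrite -ler_pdivrMl// mulrC ltW// truncnS_gt.
  apply: le_trans (_ : 1 + (eps / 2) *+ a.+1 <= _).
    by rewrite -mulr_natr; lra.
  by apply: bernoulli_inequality; lra.
have [S hS leS] := has_tester_is_memory_complexity (walk_has_tester g0G eps0 hg hG ha).
exists S; split=> //.
apply: (@le_trans _ _ (2 * ((n.+1 + n.+1) * G.+1 * (3 * a).+2))%:R).
  by rewrite ler_nat; apply: leq_trans leS _; rewrite !card_prod card_bool !card_ord.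
have lnN : ln 2 <= ln n.+1%:R :> R by rewrite ler_ln ?posrE ?ltr0Sn// ler_nat.
(* The additive constant 2 g0 + 3 is absorbed by ln(n+1) / ln 2 >= 1, as there are at least two
   symbols. *)
have hG1 : G.+1%:R <= (2 * g0 + 4)%:R * (ln n.+1%:R / ln 2) :> R.
  rewrite mulrA ler_pdivlMr//.
  have : ln 2 * (2 * g0 + 3)%:R <= ln n.+1%:R * (2 * g0 + 3)%:R :> R.
    by rewrite ler_wpM2r.
  have := trunc_log_le_ln R n.
  have -> : G.+1 = (trunc_log 2 n.+1 + (2 * g0 + 3))%N by rewrite /G; lia.
  have -> : (2 * g0 + 4)%N = (2 * g0 + 3).+1 by lia.
  by rewrite natrD -[(2 * g0 + 3).+1%:R]natr1; nra.
have ha2 : (3 * a).+2%:R <= 14 / eps.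
  have : 1 <= eps^-1 by rewrite invf_ge1// ltW.
  have : a%:R <= 4 / eps by rewrite truncn_le// divr_ge0// ltW.
  by rewrite -[(3 * a).+2%:R]natr1 -[(3 * a).+1%:R]natr1 natrM; lra.
rewrite !natrM natrD.
apply: (@le_trans _ _ (2 * ((n.+1%:R + n.+1%:R) *
    ((2 * g0 + 4)%:R * (ln n.+1%:R / ln 2)) * (14 / eps)))).
  rewrite ler_pM2l//; apply: ler_pM => //.
  by rewrite ler_wpM2l// addr_ge0.
rewrite le_eqVlt; apply/orP; left; apply/eqP; field.
by rewrite !lt0r_neq0.
Qed.
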